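(* Let $n\ge 1$ be an integer, let $K\subset\mathbb{C}$ be a compact set and let $w:K\to[0,\infty)$ be a bounded function that is nonzero on at least $n+1$ points of $K$. Then the weighted Chebyshev polynomial of degree $n$ on $K$ with respect to $w$ is unique; that is, any two monic polynomials of degree $n$ with complex coefficients that both minimize $\|\cdot\|_{K,w}$ among all monic polynomials of degree $n$ are equal.
   Context: $\|P\|_{K,w}=\sup_{z\in K}w(z)|P(z)|$. A weighted Chebyshev polynomial of degree $n$ on $K$ with respect to $w$ is a monic polynomial of degree $n$ that minimizes $\|\cdot\|_{K,w}$ among all monic polynomials of degree $n$. The weight $w$ is not assumed to be continuous or upper semi-continuous. *)

(* Defs.v *)
From mathcomp Require Import all_boot all_order all_algebra.
From mathcomp Require Import all_classical all_reals all_analysis.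
From mathcomp Require Import complex.

Set Implicit Arguments.
Unset Strict Implicit.
Unset Printing Implicit Defensive.

Import Order.TTheory GRing.Theory Num.Theory.
Import numFieldNormedType.Exports.

Local Open Scope ring_scope.
Local Open Scope classical_set_scope.
Local Open Scope complex_scope.

(* A weight on K is a total function w : R[i] -> R of which only the values on
   K are used. The modulus is [normc], which is R-valued, whereas `|z| lies in
   R[i]. The supremum is taken in \bar R, so it is meaningful without assuming
   that w or K is bounded; it is -oo when K is empty. *)
Definition weighted_norm (R : realType) (K : set R[i]) (w : R[i] -> R)
    (P : {poly R[i]}) : \bar R :=
  ereal_sup [set (w z * ComplexField.Normc.normc P.[z])%:E | z in K].

Definition monic_of_degree (R : realType) (n : nat) (P : {poly R[i]}) : Prop :=
  P \is monic /\ size P = n.+1.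

Definition weighted_chebyshev (R : realType) (K : set R[i]) (w : R[i] -> R)
    (n : nat) (P : {poly R[i]}) : Prop :=
  monic_of_degree n P /\
  forall Q : {poly R[i]}, monic_of_degree n Q ->
    (weighted_norm K w P <= weighted_norm K w Q)%E.

(* Main.v *)
(* If P <> Q are both minimizers with norm M, put D = P - Q, T = P - D / 2 and
   divide: T = q D + S with deg S < deg D < n. On K, |q| is bounded by some C
   and the parallelogram law gives (w|T|)^2 + (w|D|)^2 / 4 <= M^2. The monic
   polynomial T - e S = (1 - e) T + e q D then satisfies, by Cauchy-Schwarz,
     (w|T - e S|)^2 <= ((1 - e)^2 + 4 (e C)^2) M^2,
   and the right-hand side is (1 - e) M^2 < M^2 for e = 1 / (1 + 4 C^2). *)
Require Import Defs.
From mathcomp Require Import all_boot all_order all_algebra.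
From mathcomp Require Import all_classical all_reals all_analysis.
From mathcomp Require Import complex.
From mathcomp Require Import ring lra.

Import Order.TTheory GRing.Theory Num.Theory.
Import numFieldNormedType.Exports.

Local Open Scope ring_scope.
Local Open Scope classical_set_scope.
Local Open Scope card_scope.
Local Open Scope complex_scope.

Import ComplexField.Normc.

Lemma normc_sqr {R : rcfType} (a b : R) : normc (a +i* b) ^+ 2 = a ^+ 2 + b ^+ 2.
Proof. by rewrite /= sqr_sqrtr // addr_ge0 ?sqr_ge0. Qed.

(** This is the parallelogram law for [u] and [u - d]: their half-sum is [u - d / 2] and their
    half-difference is [d / 2]. *)
Lemma normc_midpoint {R : rcfType} (u d : R[i]) :
  normc (u - (2^-1)%:C * d) ^+ 2 + normc d ^+ 2 / 4 =
  (normc u ^+ 2 + normc (u - d) ^+ 2) / 2.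
Proof.
case: u d => [a b] [c e].
have -> : (a +i* b) - (2^-1)%:C * (c +i* e) = (a - c / 2) +i* (b - e / 2).
  by simpc; congr (_ +i* _); field.
have -> : (a +i* b) - (c +i* e) = (a - c) +i* (b - e) by simpc.
by rewrite !normc_sqr; field.
Qed.

Lemma normcC {R : rcfType} (x : R) : 0 <= x -> normc x%:C = x.
Proof. by move=> x0; rewrite /= expr0n addr0 sqrtr_sqr ger0_norm. Qed.

Lemma normE {R : rcfType} (x : R[i]) : `|x| = (normc x)%:C.
Proof. by []. Qed.

Lemma normc_ge0 {R : rcfType} (x : R[i]) : 0 <= normc x.
Proof. by case: x => a b; exact: sqrtr_ge0. Qed.

Lemma ler_normcD {R : rcfType} (x y : R[i]) : normc (x + y) <= normc x + normc y.
Proof. by have := ler_normD x y; rewrite !normE -rmorphD lecR. Qed.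

Lemma ler_dist_normc {R : rcfType} (x y : R[i]) :
  `|normc x - normc y| <= normc (x - y).
Proof.
have tri (u v : R[i]) : normc u <= normc (u - v) + normc v.
  by have := ler_normcD (u - v) v; rewrite subrK.
have := tri x y; have := tri y x.
have -> : normc (y - x) = normc (x - y).
  by apply: complexI; rewrite -!normE distrC.
by rewrite ler_norml => ? ?; lra.
Qed.

Lemma continuous_normc {R : realType} :
  continuous (@normc R : (R[i])^o -> R).
Proof.
move=> x; apply/(@cvgrPdist_lt _ _ _ (nbhs (x : (R[i])^o))) => e e0.
have e0' : 0 < e%:C by rewrite ltcR.
apply/(@nbhs_ballP _ (R[i])^o); exists e%:C => //= y.
rewrite /ball /= normE ltcR; apply: le_lt_trans.
exact: ler_dist_normc.
Qed.

Lemma bounded_normc_compact {R : realType} (K : set R[i]) :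
  compact (K : set (R[i])^o) -> exists B : R, forall z, K z -> normc z <= B.
Proof.
move=> cK.
have := continuous_compact (continuous_subspaceT (@continuous_normc R)) cK.
move=> /compact_bounded [M [Mreal MK]].
(* [compact_bounded] bounds the image only by numbers strictly above [M], hence the choice of
   [|M| + 1]. *)
have M1 : M < `|M| + 1 by rewrite (le_lt_trans (real_ler_norm Mreal)) // ltrDl.
exists (`|M| + 1) => z Kz.
by rewrite (le_trans (ler_norm _)) // MK //; exists z.
Qed.

Lemma horner_normc_bounded {R : rcfType} (K : set R[i]) (B : R) (p : {poly R[i]}) :
  (forall z, K z -> normc z <= B) ->
  exists C : R, forall z, K z -> normc p.[z] <= C.
Proof.
move=> KB; elim/poly_ind: p => [|p c [C pC]].
  by exists 0 => z _; rewrite horner0 normc0.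
exists (C * B + normc c) => z Kz.
rewrite hornerMXaddC (le_trans (ler_normcD _ _)) // lerD2r normcM.
by apply: ler_pM; [exact: normc_ge0 | exact: normc_ge0 | exact: pC | exact: KB].
Qed.

(** Otherwise the injection of [I_n.+1] into [A] would list [n + 1] distinct roots of a polynomial
    of degree [n]. *)
Lemma card_le_nonroot {F : fieldType} (n : nat) (A : set F) (p : {poly F}) :
  `I_n.+1 #<= A -> size p = n.+1 -> exists2 z, A z & p.[z] != 0.
Proof.
move=> /card_leP[f] sp; apply: contrapT => noz.
have p0 : p != 0 by rewrite -size_poly_gt0 sp.
pose g (i : 'I_n.+1) : F := val (f (SigSub (mem_set (ltn_ord i : `I_n.+1 i)))).
have := @max_poly_roots _ p [seq g i | i <- enum 'I_n.+1] p0.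
rewrite size_map size_enum_ord sp ltnn => H.
suff: false by []; apply: H.
  apply/allP => _ /mapP[i _ ->]; apply: contrapT => /negP nr.
  by apply: noz; exists (g i) => //; exact/set_mem/valP.
rewrite map_inj_uniq ?enum_uniq// => i j /val_inj /inj.
rewrite !in_setT => /(_ isT isT)/(congr1 val) /=.
exact: val_inj.
Qed.

(** Cauchy-Schwarz for the vectors [(1 - eps, 2 * eps * C)] and [(a, d / 2)]. The choice of [eps]
    gives [4 * eps * C ^+ 2 = 1 - eps], so the first has squared length [1 - eps]. *)
Lemma cauchy_schwarz2 {R : realFieldType} (a d M eps C : R) :
  a ^+ 2 + d ^+ 2 / 4 <= M ^+ 2 -> eps * (1 + 4 * C ^+ 2) = 1 ->
  ((1 - eps) * a + eps * C * d) ^+ 2 <= (1 - eps) * M ^+ 2.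
Proof.
move=> h e.
have den0 : 0 < 1 + 4 * C ^+ 2 by have := sqr_ge0 C; lra.
have e0 : 0 < eps by rewrite -(pmulr_lgt0 _ den0) e.
have coef : (1 - eps) ^+ 2 + 4 * (eps * C) ^+ 2 = 1 - eps by nra.
rewrite -{2}coef.
have : 0 <= ((1 - eps) ^+ 2 + 4 * (eps * C) ^+ 2) * (M ^+ 2 - (a ^+ 2 + d ^+ 2 / 4)).
  apply: mulr_ge0; last by rewrite subr_ge0.
  by have := sqr_ge0 (1 - eps); have := sqr_ge0 (eps * C); lra.
(* By Lagrange's identity, this square is exactly the defect in Cauchy-Schwarz. *)
have := sqr_ge0 (2 * (eps * C) * a - (1 - eps) * d / 2).
by lra.
Qed.

(** The bounds on [w] and [P] exclude [+oo]; a point of [K] excludes [-oo]. *)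
Lemma weighted_norm_fin {R : realType} (K : set R[i]) (w : R[i] -> R)
    (P : {poly R[i]}) :
  compact (K : set (R[i])^o) -> (forall z, K z -> 0 <= w z) ->
  has_ubound (w @` K) -> K !=set0 ->
  exists M : R, weighted_norm K w P = M%:E.
Proof.
move=> /bounded_normc_compact[B KB] w0 [W KW] [z0 Kz0].
have [C PC] := horner_normc_bounded K B P KB.
exists (sup [set w z * normc P.[z] | z in K]).
rewrite /weighted_norm -ereal_sup_EFin.
- by rewrite image_comp.
- exists (W * C) => _ [z Kz <-].
  by apply: ler_pM; [exact: w0 | exact: normc_ge0 | apply: KW; exists z | exact: PC].
- by exists (w z0 * normc P.[z0]), z0.
Qed.

Lemma weighted_norm_ge {R : realType} (K : set R[i]) (w : R[i] -> R)
    (P : {poly R[i]}) (M : R) (z : R[i]) :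
  weighted_norm K w P = M%:E -> K z -> w z * normc P.[z] <= M.
Proof.
by move=> PM Kz; rewrite -lee_fin -PM; apply: ereal_sup_ubound; exists z.
Qed.

Lemma weighted_norm_le {R : realType} (K : set R[i]) (w : R[i] -> R)
    (P : {poly R[i]}) (M : R) :
  (forall z, K z -> w z * normc P.[z] <= M) -> (weighted_norm K w P <= M%:E)%E.
Proof. by move=> PM; apply: ge_ereal_sup => _ [z Kz <-]; rewrite lee_fin PM. Qed.

Lemma monic_of_degreeB {R : realType} (n : nat) (P Q : {poly R[i]}) :
  monic_of_degree n P -> monic_of_degree n Q -> (size (P - Q)%R <= n)%N.
Proof.
move=> [mP sP] [mQ sQ]; apply/leq_sizeP => j; rewrite leq_eqVlt coefB.
case/orP => [/eqP <-|nj].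
  have -> : P`_n = 1 by rewrite -(monicP mP) /lead_coef sP.
  have -> : Q`_n = 1 by rewrite -(monicP mQ) /lead_coef sQ.
  exact: subrr.
by rewrite !nth_default ?subrr ?sP ?sQ.
Qed.

Lemma monic_of_degreeD {R : realType} (n : nat) (P S : {poly R[i]}) :
  monic_of_degree n P -> (size S <= n)%N -> monic_of_degree n (P + S).
Proof.
move=> [mP sP] sS; have lt : (size S < size P)%N by rewrite sP ltnS.
by split; [rewrite monicE lead_coefDl // -monicE | rewrite size_polyDl].
Qed.

(* (R[i])^o is R[i] seen with the topology given by its norm. *)
Theorem corollary6 (R : realType) (n : nat) (hn : (1 <= n)%N)
    (K : set R[i]) (hK : compact (K : set (R[i])^o))
    (w : R[i] -> R) (w_ge0 : forall z, K z -> 0 <= w z)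
    (w_bounded : has_ubound (w @` K))
    (w_supp : `I_n.+1 #<= [set z | K z /\ w z != 0])
    (P Q : {poly R[i]})
    (hP : weighted_chebyshev K w n P) (hQ : weighted_chebyshev K w n Q) :
  P = Q.
Proof.
have [Pn Pmin] := hP; have [Qn Qmin] := hQ.
(* The point [z0] serves twice: it shows that [K] is nonempty, so that the norms are finite, and
   that [M] is positive. *)
have [z0 [Kz0 wz0] Pz0] := card_le_nonroot n _ P w_supp Pn.2.
have [M PM] := weighted_norm_fin K w P hK w_ge0 w_bounded (ex_intro _ z0 Kz0).
have QM : weighted_norm K w Q = M%:E.
  by apply/le_anti; rewrite -PM Pmin ?Qmin.
have M0 : 0 < M.
  apply: lt_le_trans (weighted_norm_ge _ _ _ _ _ PM Kz0).
  rewrite mulr_gt0 // lt0r ?wz0 ?w_ge0 // normc_ge0 andbT.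
  by apply: contra Pz0 => /eqP/eq0_normc ->.
apply/eqP; rewrite -subr_eq0; apply/negPn/negP.
set D := P - Q => D0.
have sD : (size D <= n)%N by exact: monic_of_degreeB.
pose T := P - (2^-1)%:C *: D.
have [B KB] := bounded_normc_compact K hK.
have [C qC] := horner_normc_bounded K B (T %/ D) KB.
pose e := (1 + 4 * C ^+ 2)^-1.
have den0 : 0 < 1 + 4 * C ^+ 2 by have := sqr_ge0 C; lra.
have eE : e * (1 + 4 * C ^+ 2) = 1 by rewrite mulVf // gt_eqF.
have e0 : 0 < e by rewrite invr_gt0.
have e1 : e <= 1 by rewrite invf_le1 // lerDl mulr_ge0 ?sqr_ge0.
have sS : (size (T %% D)%R <= n)%N by apply: leq_trans sD; rewrite ltnW ?ltn_modp.
(* The competitor is [T - e S] with [S = T %% D], written as [P] plus terms of degree below [n] so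
   that it is visibly monic. *)
have VN : monic_of_degree n (P + (- ((2^-1)%:C *: D) - e%:C *: (T %% D))).
  apply: monic_of_degreeD => //; rewrite (leq_trans (size_polyD _ _)) // geq_max.
  by rewrite !size_polyN !(leq_trans (size_scale_leq _ _)).
suff : (weighted_norm K w (P + (- ((2^-1)%:C *: D) - e%:C *: (T %% D)))
        <= (Num.sqrt (1 - e) * M)%:E)%E.
  move=> /(le_trans (Pmin _ VN)); rewrite PM lee_fin leNgt => /negP; apply.
  rewrite gtr_pMl // -[ltRHS]sqrtr1 ltr_sqrt //; lra.
apply: weighted_norm_le => z Kz.
have w0 := w_ge0 z Kz.
(* The remainder is traded for the quotient: on [K], [T %/ D] is bounded by [C], so only the
   weighted sizes of [T] and [D] remain to be controlled. *)
have -> : P + (- ((2^-1)%:C *: D) - e%:C *: (T %% D)) =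
    (1 - e)%:C *: T + e%:C *: (T %/ D * D).
  have -> : T %/ D * D = T - T %% D.
    by apply/eqP; rewrite eq_sym subr_eq -divp_eq.
  by rewrite addrA -/T rmorphB rmorph1 scalerBl scale1r (scalerBr _ T) addrA subrK.
set t := w z * normc T.[z]; set d := w z * normc D.[z].
(* Since [P - D = Q], the right-hand side of [normc_midpoint] averages two squares, each at most
   [M ^+ 2] after weighting. *)
have td : t ^+ 2 + d ^+ 2 / 4 <= M ^+ 2.
  have mid := normc_midpoint P.[z] D.[z].
  have QE : P.[z] - D.[z] = Q.[z] by rewrite -hornerN -hornerD opprB addrC subrK.
  have TE : P.[z] - (2^-1)%:C * D.[z] = T.[z] by rewrite /T hornerD hornerN hornerZ.
  rewrite QE TE in mid.
  have -> : t ^+ 2 + d ^+ 2 / 4 =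
      w z ^+ 2 * (normc T.[z] ^+ 2 + normc D.[z] ^+ 2 / 4).
    by rewrite /t /d; ring.
  rewrite mid.
  have sq (U : {poly R[i]}) : weighted_norm K w U = M%:E ->
      (w z * normc U.[z]) ^+ 2 <= M ^+ 2.
    move=> UM; rewrite lerXn2r ?nnegrE ?mulr_ge0 ?normc_ge0 ?(ltW M0) //.
    exact: weighted_norm_ge UM Kz.
  by have := sq P PM; have := sq Q QM; lra.
apply: (@le_trans _ _ ((1 - e) * t + e * C * d)).
  rewrite hornerD !hornerZ hornerM.
  apply: (le_trans (ler_wpM2l w0 (ler_normcD _ _))).
  rewrite !normcM !normcC ?subr_ge0 ?(ltW e0) // mulrDr.
  rewrite lerD //; first by rewrite mulrCA.
  have := ler_wpM2l (mulr_ge0 (ltW e0) (mulr_ge0 w0 (normc_ge0 D.[z]))) (qC z Kz).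
  by rewrite /d; congr (_ <= _); ring.
have C0 : 0 <= C by apply: le_trans (qC z Kz); exact: normc_ge0.
(* Both sides are nonnegative, so they become square roots of their squares and the claim reduces to
   [cauchy_schwarz2]. *)
rewrite -[leLHS]ger0_norm; last first.
  by rewrite addr_ge0 // !mulr_ge0 ?normc_ge0 ?subr_ge0 // ltW.
rewrite -sqrtr_sqr -[M in leRHS]gtr0_norm // -sqrtr_sqr -sqrtrM ?subr_ge0 //.
by rewrite ler_wsqrtr // cauchy_schwarz2.
Qed.
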